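(* Let $\mathbb{F}_{p^s}$ be a finite extension of $\mathbb{F}_{p^r}$ and let $c\in\mathbb{F}_{p^s}$. Then the following hold. 1. If $c\in W(\mathbb{F}_{p^s})$, then $\mathrm{Tr}_{\mathbb{F}_{p^s}/\mathbb{F}_p}(cR(c))=0$. 2. We have $c\in W(\mathbb{F}_{p^s})$ if and only if there exists a polynomial $B(X)\in\mathbb{F}_{p^s}[X]$ with $$B(X)^p-B(X)=cR(X)+R(c)X.\qquad( * )$$ Moreover, for $c\in W(\mathbb{F}_{p^s})$ there is a unique solution $B_c(X)\in X\mathbb{F}_{p^s}[X]$ to equation $( * )$, and: (a) the polynomial $B_c(X)$ is additive; (b) every solution $B(X)$ of $( * )$ is of the form $B(X)=B_c(X)+\beta$ for some $\beta\in\mathbb{F}_p$; (c) if $c_1,c_2\in W(\mathbb{F}_{p^s})$, then $B_{c_1+c_2}(X)=B_{c_1}(X)+B_{c_2}(X)$. 3. We have $c\in W(\mathbb{F}_{p^s})$ if and only if $E(c)=0$. In other words, $W(\mathbb{F}_{p^s})=W\cap\mathbb{F}_{p^s}$.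
   Context: Let $p$ be an odd prime, $k=\overline{\mathbb{F}}_p$, $h\ge 0$, and $R(X)=\sum_{i=0}^h a_iX^{p^i}\in\mathbb{F}_{p^r}[X]$ with $a_h\neq 0$ (an additive polynomial of degree $p^h$; a polynomial $F$ is additive if $F(X+Y)=F(X)+F(Y)$). Put $E(X)=R(X)^{p^h}+\sum_{i=0}^h (a_iX)^{p^{h-i}}\in\mathbb{F}_{p^r}[X]$ and $W=\{c\in k: E(c)=0\}$. For an extension $\mathbb{F}_{p^s}$ of $\mathbb{F}_{p^r}$, define $$W(\mathbb{F}_{p^s})=\{c\in\mathbb{F}_{p^s}:\mathrm{Tr}_{\mathbb{F}_{p^s}/\mathbb{F}_p}(cR(y)+yR(c))=0\text{ for all }y\in\mathbb{F}_{p^s}\}.$$ *)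

(* Defs.v *)
From HB Require Import structures.
From mathcomp Require Import all_boot all_order all_algebra all_fingroup all_solvable all_field.

Set Implicit Arguments.
Unset Strict Implicit.
Unset Printing Implicit Defensive.

Import GRing.Theory.
Local Open Scope ring_scope.

Definition additive_poly (F : fieldType) (f : {poly F}) : Prop :=
  poly_XaY f = f^:P + f%:P.

Definition polyR (p : nat) (F : fieldType) (h : nat) (a : 'I_h.+1 -> F) :
    {poly F} :=
  \sum_(i < h.+1) a i *: 'X^(p ^ i).

Definition polyE (p : nat) (F : fieldType) (h : nat) (a : 'I_h.+1 -> F) :
    {poly F} :=
  polyR p a ^+ (p ^ h) + \sum_(i < h.+1) (a i *: 'X) ^+ (p ^ (h - i)).

(* A finite field of characteristic p is a finite extension L of 'F_p; all such
   extensions are normal, so [splittingFieldType] only serves to give access to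
   the Galois-theoretic trace of the library.  The subfield 1 of L is 'F_p. *)
Definition absTrace (p : nat) (L : splittingFieldType 'F_p) (x : L) : L :=
  galTrace 1%AS {:L}%AS x.

Definition inW_fin (p : nat) (L : splittingFieldType 'F_p) (h : nat)
    (a : 'I_h.+1 -> L) (c : L) : Prop :=
  let R := polyR p a in
  forall y : L, absTrace (c * R.[y] + y * R.[c]) = 0.

Definition inW (p : nat) (L k : fieldType) (iota : {rmorphism L -> k})
    (h : nat) (a : 'I_h.+1 -> L) (z : k) : Prop :=
  (map_poly iota (polyE p a)).[z] = 0.

Definition AS_solution (p : nat) (F : fieldType) (h : nat)
    (a : 'I_h.+1 -> F) (c : F) (B : {poly F}) : Prop :=
  B ^+ p - B = c *: polyR p a + (polyR p a).[c] *: 'X.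

(* Main.v *)
(* Raising to p-th powers does not change traces to F_p, so the trace form
   y |-> Tr(cR(y) + yR(c)) equals y |-> Tr(E(c) y^(p^h)); as the trace is
   nonzero and Frobenius is bijective, it vanishes identically iff E(c) = 0.
   Likewise every M is congruent to M^(p^n) modulo polynomials B^p - B, through
   B = -(M + M^p + ... + M^(p^(n-1))); hence cR(X) + R(c)X is congruent to
   E(c) X^(p^h), with an explicit additive B.  Two solutions differ by a
   polynomial D with D^p = D, which is a constant of F_p. *)
Require Import Defs.
From HB Require Import structures.
From mathcomp Require Import all_boot all_order all_algebra all_fingroup all_solvable all_field.

Set Implicit Arguments.
Unset Strict Implicit.
Unset Printing Implicit Defensive.

Import GRing.Theory.
Local Open Scope ring_scope.

(** * Iterated Frobenius and telescoping sums in characteristic p *)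

Section FrobeniusSum.

Variables (R : comNzRingType) (p : nat).
Hypothesis charRp : p \in [pchar R].

Lemma expr_pcharD n : {morph (fun x : R => x ^+ (p ^ n)) : x y / x + y}.
Proof.
move=> x y; apply: exprDn_pchar.
by rewrite pnatX pnatE ?(pcharf_prime charRp) // charRp.
Qed.

Lemma expr_pcharN n (x : R) : (- x) ^+ (p ^ n) = - x ^+ (p ^ n).
Proof.
apply: exprNn_pchar.
by rewrite pnatX pnatE ?(pcharf_prime charRp) // charRp.
Qed.

Lemma expr_pchar_sum n I (r : seq I) (P : pred I) (f : I -> R) :
  (\sum_(i <- r | P i) f i) ^+ (p ^ n) = \sum_(i <- r | P i) f i ^+ (p ^ n).
Proof.
apply: (big_morph _ (@expr_pcharD n)).
by rewrite expr0n expn_eq0 eqn0Ngt prime_gt0 ?(pcharf_prime charRp).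
Qed.

Lemma expp_pchar_sum I (r : seq I) (P : pred I) (f : I -> R) :
  (\sum_(i <- r | P i) f i) ^+ p = \sum_(i <- r | P i) f i ^+ p.
Proof. exact: (expr_pchar_sum 1). Qed.

Lemma expp_pcharD (x y : R) : (x + y) ^+ p = x ^+ p + y ^+ p.
Proof. exact: (expr_pcharD 1). Qed.

Lemma expp_pcharN (x : R) : (- x) ^+ p = - x ^+ p.
Proof. exact: (expr_pcharN 1). Qed.

(** An Artin-Schreier preimage of [x ^+ (p ^ n) - x]; below, [x] is a polynomial. *)
Definition frob_sum n (x : R) := \sum_(j < n) x ^+ (p ^ j).

Lemma frob_sumP n (x : R) : frob_sum n x ^+ p - frob_sum n x = x ^+ (p ^ n) - x.
Proof.
rewrite /frob_sum expp_pchar_sum -sumrB.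
under eq_bigr => j _ do rewrite -exprM -expnSr.
rewrite -(big_mkord predT (fun j => x ^+ (p ^ j.+1) - x ^+ (p ^ j))).
by rewrite telescope_sumr // expn0 expr1.
Qed.

End FrobeniusSum.

Lemma pchar_poly_in (F : nzRingType) p :
  p \in [pchar F] -> p \in [pchar {poly F}].
Proof. by move=> chp; rewrite pchar_poly. Qed.

(** * Additive polynomials, divisibility by X, polynomials fixed by Frobenius *)

Section AdditivePoly.

Variables (F : fieldType) (p : nat).
Hypothesis charFp : p \in [pchar F].
Implicit Types f g : {poly F}.

Lemma additive_poly0 : additive_poly (0 : {poly F}).
Proof. by rewrite /additive_poly poly_XaY0 map_poly0 polyC0 addr0. Qed.

Lemma additive_polyD f g :
  additive_poly f -> additive_poly g -> additive_poly (f + g).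
Proof.
rewrite /additive_poly /poly_XaY => adf adg.
by rewrite rmorphD /= comp_polyD adf adg polyCD addrACA.
Qed.

Lemma additive_polyN f : additive_poly f -> additive_poly (- f).
Proof.
rewrite /additive_poly /poly_XaY => adf.
by rewrite rmorphN /= raddfN /= adf polyCN opprD.
Qed.

Lemma additive_poly_sum I (r : seq I) (f : I -> {poly F}) :
  (forall i, additive_poly (f i)) -> additive_poly (\sum_(i <- r) f i).
Proof.
by move=> adf; apply: big_ind => //; [apply: additive_poly0 | apply: additive_polyD].
Qed.

Lemma additive_polyX : additive_poly ('X : {poly F}).
Proof. by rewrite /additive_poly /poly_XaY map_polyX comp_polyX. Qed.

Lemma additive_polyZ b f : additive_poly f -> additive_poly (b *: f).
Proof.
rewrite /additive_poly /poly_XaY -mul_polyC rmorphM /= map_polyC => adf.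
by rewrite comp_polyM comp_polyC adf mulrDr -polyCM.
Qed.

Lemma additive_poly_exp f n : additive_poly f -> additive_poly (f ^+ (p ^ n)).
Proof.
rewrite /additive_poly /poly_XaY => adf.
rewrite rmorphXn /= rmorphXn /= adf expr_pcharD ?polyC_exp //.
(* The identity lives in [{poly {poly F}}], so the characteristic is lifted twice. *)
exact/pchar_poly_in/pchar_poly_in.
Qed.

Lemma additive_frob_sum f n : additive_poly f -> additive_poly (frob_sum p n f).
Proof.
move=> adf; rewrite /frob_sum.
by apply: additive_poly_sum => j; apply: additive_poly_exp.
Qed.

Lemma dvdX_frob_sum f n : 'X %| f -> 'X %| frob_sum p n f.
Proof.
move=> Xf; rewrite /frob_sum; elim/big_ind: _ => [|g1 g2|j _].
- exact: dvdp0.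
- exact: dvdp_add.
- by apply: dvdp_exp; rewrite ?expn_gt0 ?prime_gt0 ?(pcharf_prime charFp).
Qed.

(** The p-th power multiplies the degree by p > 1, so only constants can be fixed. *)
Lemma fixed_exp_poly f : f ^+ p = f -> exists2 d, f = d%:P & d ^+ p = d.
Proof.
have p_gt1 := prime_gt1 (pcharf_prime charFp); move=> fE.
have: (size f <= 1)%N.
  rewrite leqNgt; apply/negP => f_gt1.
  have:= congr1 (fun g : {poly F} => (size g).-1) fE; rewrite size_exp.
  by apply/eqP; rewrite -{2}[(size f).-1]muln1 eqn_pmul2l -?subn1 ?subn_gt0 ?gtn_eqF.
move/size1_polyC => fC.
exists f`_0 => //; move: fE; rewrite fC coefC /= -polyC_exp.
exact: polyC_inj.
Qed.

End AdditivePoly.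

(** * The trace form, the polynomial E and explicit Artin-Schreier solutions *)

Section Proposition.

Variables (p : nat) (p_prime : prime p) (L : splittingFieldType 'F_p).
Variables (h : nat) (a : 'I_h.+1 -> L).

Lemma pchar_ext : p \in [pchar L].
Proof. by rewrite pchar_lalg pchar_Fp. Qed.
Let charLp := pchar_ext.

Lemma mem1_expp (x : L) : (x \in 1%VS) = (x ^+ p == x).
Proof. by rewrite (Fermat's_little_theorem 1%AS) dimv1 expn1 card_Fp. Qed.

Lemma absTraceD : {morph @absTrace p L : x y / x + y}.
Proof. exact: raddfD. Qed.

Lemma absTraceB : {morph @absTrace p L : x y / x - y}.
Proof. exact: raddfB. Qed.

(** Frobenius commutes with every automorphism, so Tr(x^p) = Tr(x)^p, and Tr(x) lies in F_p, where
    Frobenius is the identity. *)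
Lemma absTrace_expp n (x : L) : absTrace (x ^+ (p ^ n)) = absTrace x.
Proof.
elim: n => [|n IHn]; first by rewrite expr1.
rewrite expnSr exprM -[RHS]IHn; move: (x ^+ _) => {IHn}x.
have: absTrace x \in 1%VS.
  by rewrite (mem_galTrace (finField_galois (sub1v _))) ?memvf.
rewrite mem1_expp => /eqP <-.
rewrite /absTrace /galTrace (expp_pchar_sum charLp).
by apply: eq_bigr => g _; rewrite rmorphXn.
Qed.

(** Independence of the automorphisms, with all coefficients 1, gives some y of nonzero trace; if u
    were nonzero, [u^-1 * y] would contradict the hypothesis. *)
Lemma absTrace_nondegenerate (u : L) :
  (forall y, absTrace (u * y) = 0) -> u = 0.
Proof.
move=> tr0; apply: contraTeq isT => u_neq0.
have [y _] := @gal_independent_contra _ L {:L}%AS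
  (fun g => g \in 'Gal({:L} / 1)%g) (fun=> 1) 1%g (group1 _) (oner_neq0 _).
rewrite (eq_bigr (fun g : gal_of {:L} => g y)) => [|g _]; last by rewrite mul1r.
by have:= tr0 (u^-1 * y); rewrite mulVKf // /absTrace /galTrace => ->; rewrite eqxx.
Qed.

(** With d the degree of L over F_p, x^(p^d) = x, so x^(p^(d-1)) is a p-th root of x. *)
Lemma expp_surj n (y : L) : exists x : L, y = x ^+ (p ^ n).
Proof.
elim: n y => [|n IHn] y; first by exists y; rewrite expr1.
have [x ->] := IHn y.
have := memvf x; rewrite (Fermat's_little_theorem {:L}%AS) card_Fp //.
set d := \dim _ => /eqP xE; have d_gt0 : (0 < d)%N by apply: adim_gt0.
exists (x ^+ (p ^ d.-1)).
by rewrite -[in LHS]xE -!exprM -!expnD addnS -addSn prednK.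
Qed.

Lemma horner_polyR (y : L) : (polyR p a).[y] = \sum_(i < h.+1) a i * y ^+ (p ^ i).
Proof. by rewrite horner_sum; apply: eq_bigr => i _; rewrite !hornerE. Qed.

Lemma horner_polyE (c : L) :
  (polyE p a).[c] =
  (polyR p a).[c] ^+ (p ^ h) + \sum_(i < h.+1) (c * a i) ^+ (p ^ (h - i)).
Proof.
rewrite hornerD horner_exp; congr (_ + _).
by rewrite horner_sum; apply: eq_bigr => i _; rewrite horner_exp !hornerE mulrC.
Qed.

Lemma horner_polyRD (x y : L) :
  (polyR p a).[x + y] = (polyR p a).[x] + (polyR p a).[y].
Proof.
rewrite !horner_polyR -big_split; apply: eq_bigr => i _ /=.
by rewrite expr_pcharD // mulrDr.
Qed.

(** Inside the trace, yR(c) may be raised to the power p^h and each c a_i y^(p^i) to the power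
    p^(h-i); every term then carries y^(p^h), and the coefficients add up to E(c). *)
Lemma absTrace_polyR (c y : L) :
  absTrace (c * (polyR p a).[y] + y * (polyR p a).[c]) =
  absTrace ((polyE p a).[c] * y ^+ (p ^ h)).
Proof.
rewrite absTraceD horner_polyR horner_polyE mulrDl absTraceD addrC.
congr (_ + _); first by rewrite -[LHS](absTrace_expp h) exprMn mulrC.
rewrite mulr_sumr mulr_suml /absTrace !raddf_sum; apply: eq_bigr => i _ /=.
by rewrite -[LHS](absTrace_expp (h - i)) mulrA exprMn -exprM -expnD subnKC ?leq_ord //.
Qed.

Lemma inW_finE (c : L) : inW_fin a c <-> (polyE p a).[c] = 0.
Proof.
split=> [cW|Ec R y]; last by rewrite /R absTrace_polyR // Ec mul0r [LHS]raddf0.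
apply: absTrace_nondegenerate => y; have [x ->] := expp_surj h y.
by rewrite -absTrace_polyR.
Qed.

Lemma inW_finD (c1 c2 : L) :
  inW_fin a c1 -> inW_fin a c2 -> inW_fin a (c1 + c2).
Proof.
move=> W1 W2 R y; rewrite {}/R horner_polyRD mulrDl mulrDr addrACA absTraceD.
by rewrite W1 W2 addr0.
Qed.

(** The exponents h - i and h are chosen so that the monomials of cR(X) and R(c)X are all moved to
    degree p^h. *)
Definition AS_sol (c : L) : {poly L} :=
  - (\sum_(i < h.+1) frob_sum p (h - i) ((c * a i) *: 'X^(p ^ i))
     + frob_sum p h ((polyR p a).[c] *: 'X)).

Lemma AS_solP (c : L) : (polyE p a).[c] = 0 -> AS_solution p a c (AS_sol c).
Proof.
have chP := pchar_poly_in charLp.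
move=> Ec; rewrite /AS_solution /AS_sol.
rewrite (expp_pcharN chP) (expp_pcharD chP) (expp_pchar_sum chP).
rewrite opprK addrC -opprB [X in - (_ + X)]opprD addrACA -sumrB frob_sumP //.
under eq_bigr => i _ do rewrite frob_sumP // exprZn -exprM -expnD subnKC ?leq_ord //.
(* The terms in X^(p^h) collect into E(c) X^(p^h), which vanishes; what remains is cR(X) + R(c)X. *)
rewrite sumrB -scaler_suml exprZn addrACA -scalerDl [_ + _ ^+ _]addrC -horner_polyE.
rewrite Ec scale0r add0r opprD !opprK /polyR scaler_sumr; congr (_ + _).
by apply: eq_bigr => i _; rewrite scalerA.
Qed.

Lemma dvdX_AS_sol (c : L) : 'X %| AS_sol c.
Proof.
rewrite /AS_sol dvdpNr; apply: dvdp_add; last first.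
  by apply: dvdX_frob_sum => //; rewrite -mul_polyC dvdp_mulIr.
elim/big_ind: _ => [|f g|i _]; [exact: dvdp0 | exact: dvdp_add |].
apply: dvdX_frob_sum => //; rewrite -mul_polyC dvdp_mull //.
by rewrite dvdp_exp ?expn_gt0 ?prime_gt0.
Qed.

Lemma additive_AS_sol (c : L) : additive_poly (AS_sol c).
Proof.
have adX := additive_polyX L; apply/additive_polyN/additive_polyD.
  apply: additive_poly_sum => i; apply: additive_frob_sum => //.
  by apply/additive_polyZ/additive_poly_exp.
by apply: additive_frob_sum => //; apply: additive_polyZ.
Qed.

(** Evaluated at y, the equation writes the trace argument as B(y)^p - B(y), which has trace
    zero. *)
Lemma AS_solution_inW (c : L) B : AS_solution p a c B -> inW_fin a c.
Proof.
move=> /(congr1 (horner^~ _)) BE R y; move: (BE y).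
rewrite {}/R !hornerE [y * _]mulrC => <-.
by rewrite absTraceB (absTrace_expp 1) subrr.
Qed.

Lemma AS_solution_sub (c : L) B1 B2 :
  AS_solution p a c B1 -> AS_solution p a c B2 ->
  exists beta : 'F_p, B1 = B2 + (beta%:A)%:P.
Proof.
rewrite /AS_solution => E1 E2; pose D := B1 - B2.
have chP := pchar_poly_in charLp.
have [|d DE dE] := @fixed_exp_poly _ _ charLp D.
  rewrite /D (expp_pcharD chP) (expp_pcharN chP).
  by apply/eqP; rewrite -subr_eq0 opprD addrACA -opprD E1 E2 subrr.
have /vlineP[beta dA] : d \in 1%VS by rewrite mem1_expp dE.
by exists beta; rewrite -dA -DE addrC subrK.
Qed.

(** Two solutions differ by a constant, and both vanish at 0. *)
Lemma AS_solution_uniq (c : L) B1 B2 :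
  'X %| B1 -> AS_solution p a c B1 -> 'X %| B2 -> AS_solution p a c B2 -> B1 = B2.
Proof.
move=> X1 E1 X2 E2; have [beta B1E] := AS_solution_sub E1 E2.
have XE (f : {poly L}) : 'X %| f -> f.[0] = 0.
  by rewrite -['X]subr0 -polyC0 dvdp_XsubCl => /rootP.
by have:= XE _ X1; rewrite B1E !hornerE XE // add0r => ->; rewrite polyC0 addr0.
Qed.

Lemma AS_solutionD (c1 c2 : L) B1 B2 :
  AS_solution p a c1 B1 -> AS_solution p a c2 B2 ->
  AS_solution p a (c1 + c2) (B1 + B2).
Proof.
rewrite /AS_solution => E1 E2.
rewrite (expp_pcharD (pchar_poly_in charLp)) opprD addrACA E1 E2.
by rewrite horner_polyRD !scalerDl addrACA.
Qed.

End Proposition.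

Theorem proposition2p1 (p : nat) (p_prime : prime p) (p_odd : odd p)
    (* L is F_(p^s), K is its subfield F_(p^r) *)
    (L : splittingFieldType 'F_p) (K : {subfield L})
    (h : nat) (a : 'I_h.+1 -> L)
    (a_in_K : forall i, a i \in K) (ah_neq0 : a ord_max != 0)
    (* k is an algebraic closure of F_p, containing L via iota *)
    (k : closedFieldType) (iota : {rmorphism L -> k})
    (k_alg : forall z : k, algebraicOver (fun u : 'F_p => iota u%:A) z) :
  [/\ (* 1 *)
      forall c : L, inW_fin a c -> absTrace (c * (polyR p a).[c]) = 0,
      (* 2 *)
      forall c : L, inW_fin a c <-> exists B : {poly L}, AS_solution p a c B,
      (forall c : L, inW_fin a c ->
         exists! B : {poly L}, 'X %| B /\ AS_solution p a c B)
      /\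
      (forall Bc : L -> {poly L},
         (forall c : L, inW_fin a c ->
            'X %| Bc c /\ AS_solution p a c (Bc c)) ->
         [/\ forall c : L, inW_fin a c -> additive_poly (Bc c),
             forall c : L, inW_fin a c -> forall B : {poly L},
               AS_solution p a c B ->
               exists beta : 'F_p, B = Bc c + (beta%:A)%:P
           & forall c1 c2 : L, inW_fin a c1 -> inW_fin a c2 ->
               inW_fin a (c1 + c2) /\ Bc (c1 + c2) = Bc c1 + Bc c2]),
      (* 3 *)
      forall c : L, inW_fin a c <-> (polyE p a).[c] = 0
    & forall z : k,
        (exists2 c : L, inW_fin a c & z = iota c) <->
        (inW p iota a z /\ exists c : L, z = iota c)].
Proof.
have charLp := pchar_ext p_prime L.
have WE := inW_finE p_prime a.
have solP c : inW_fin a c -> AS_solution p a c (AS_sol a c).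
  by move/WE; apply: AS_solP.
have XsolP c : 'X %| AS_sol a c by apply: dvdX_AS_sol.
have uniqP := @AS_solution_uniq p p_prime L h a.
split=> //.
(* Taking y = c gives 2 Tr(cR(c)) = 0, and 2 is nonzero in L because p is odd. *)
- move=> c /(_ c); rewrite absTraceD -mulr2n -mulr_natr => /eqP.
  rewrite mulf_eq0 => /orP[/eqP // | ]; rewrite -(dvdn_pcharf charLp).
  by rewrite dvdn_prime2 // => /eqP pE; rewrite pE in p_odd.
- move=> c; split=> [cW | [B]]; last exact: AS_solution_inW.
  by exists (AS_sol a c); apply: solP.
- split=> [c cW | Bc BcP].
    exists (AS_sol a c); split=> [|B [XB BE]]; first by split=> //; apply: solP.
    by apply: (uniqP c) => //; apply: solP.
  (* By uniqueness any choice of [Bc] agrees with [AS_sol] on W, hence inherits its additivity. *)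
  have BcE c : inW_fin a c -> Bc c = AS_sol a c.
    by move=> cW; have [X1 E1] := BcP c cW; apply: (uniqP c) => //; apply: solP.
  split=> [c cW | c cW B BE | c1 c2 W1 W2].
  + by rewrite BcE //; apply: additive_AS_sol.
  + by have [_ E1] := BcP c cW; apply: AS_solution_sub BE E1.
  have W12 := inW_finD p_prime W1 W2; split=> //.
  have [X1 E1] := BcP _ W1; have [X2 E2] := BcP _ W2; have [X3 E3] := BcP _ W12.
  (* Both sides are solutions for c1 + c2 divisible by X. *)
  apply: (uniqP (c1 + c2)) => //; first exact: dvdp_add.
  exact: AS_solutionD.
- move=> z; rewrite /inW; split=> [[c /WE Ec ->] | [Ez [c zE]]].
    by split; [rewrite horner_map Ec rmorph0 | exists c].
  exists c => //; apply/WE/eqP; move: Ez.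
  (* Here E(iota c) = iota(E(c)), and the field morphism [iota] is injective. *)
  by rewrite zE horner_map => /eqP; rewrite fmorph_eq0.
Qed.
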